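(* Let $n,q\in\{1,2,\ldots\}$, let $\|\cdot\|$ be a norm on $\mathbb{R}^q$, let $C\subseteq\mathbb{R}^q$ be a polyhedral closed convex cone that is solid, pointed and nontrivial, let $X\subseteq\mathbb{R}^n$ be convex, let $\Gamma\colon X\to\mathbb{R}^q$ be $C$-convex and continuous, let $\mathcal{X}\subseteq X$ be a compact convex set with nonempty interior, and let $\epsilon>0$. Then Algorithm 1 (described in the context) works correctly: if the algorithm terminates, then it returns a finite weak $\epsilon$-solution of the convex vector optimization problem of minimizing $\Gamma(x)$ with respect to $\leq_C$ subject to $x\in\mathcal{X}$.
   Context: A cone $C$ is solid if its interior is nonempty, pointed if it contains no line, nontrivial if $\{0\}\subsetneq C\subsetneq\mathbb{R}^q$. For $y_1,y_2\in\mathbb{R}^q$, $y_1\leq_C y_2$ means $y_2-y_1\in C$. $\Gamma$ is $C$-convex if $\Gamma(\lambda x_1+(1-\lambda)x_2)\leq_C\lambda\Gamma(x_1)+(1-\lambda)\Gamma(x_2)$ for all $x_1,x_2\in X$, $\lambda\in[0,1]$. The dual cone is $C^+=\{w\in\mathbb{R}^q\mid w^{\mathsf T}y\ge 0\ \forall y\in C\}$; it is polyhedral, and $w^1,\ldots,w^J$ denote fixed nonzero generating vectors of it, so $C^+=\operatorname{conv}\operatorname{cone}\{w^1,\ldots,w^J\}$. $\|\cdot\|_*$ is the dual norm. The upper image is $\mathcal{P}=\operatorname{cl}(\Gamma(\mathcal{X})+C)$. $\mathbb{B}_\epsilon=\{z\in\mathbb{R}^q\mid\|z\|\le\epsilon\}$.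 Solution concept: $\bar x\in\mathcal{X}$ is a weak minimizer if $(\{\Gamma(\bar x)\}-\operatorname{int}C)\cap\Gamma(\mathcal{X})=\emptyset$. A nonempty finite set $\bar{\mathcal{X}}\subseteq\mathcal{X}$ is a finite weak $\epsilon$-solution if it consists only of weak minimizers and $\operatorname{conv}\Gamma(\bar{\mathcal{X}})+C+\mathbb{B}_\epsilon\supseteq\mathcal{P}$. Scalarizations: for $w\in C^+\setminus\{0\}$, $(\mathrm{WS}(w))$ is: minimize $w^{\mathsf T}\Gamma(x)$ subject to $x\in\mathcal{X}$. For $v\in\mathbb{R}^q$, $(\mathrm{P}(v))$ is: minimize $\|z\|$ subject to $\Gamma(x)-z-v\le_C 0$, $x\in\mathcal{X}$, $z\in\mathbb{R}^q$; and $(\mathrm{D}(v))$ is: maximize $\inf_{x\in\mathcal{X}}w^{\mathsf T}\Gamma(x)-w^{\mathsf T}v$ subject to $\|w\|_*\le1$, $w\in C^+$. For each $v$, $(x^v,z^v)$ and $w^v$ denote arbitrary optimal solutions of $(\mathrm{P}(v))$ and $(\mathrm{D}(v))$. Algorithm 1. Initialization: compute an optimal solution $x^j$ of $(\mathrm{WS}(w^j))$ for each $j\in\{1,\ldots,J\}$; set $k=0$, $\mathcal{X}_0=\{x^1,\ldots,x^J\}$, $\mathcal{V}^{\text{known}}=\emptyset$, and $\mathcal{P}^{\text{out}}_0=\bigcap_{j=1}^J\{y\in\mathbb{R}^q\mid (w^j)^{\mathsf T}y\ge(w^j)^{\mathsf T}\Gamma(x^j)\}$. Main loop: compute the set $\mathcal{V}_k$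 of vertices of $\mathcal{P}^{\text{out}}_k$. Go through the vertices $v\in\mathcal{V}_k$ in an arbitrary order, skipping those in $\mathcal{V}^{\text{known}}$. For each $v\notin\mathcal{V}^{\text{known}}$: compute $(x^v,z^v)$ and $w^v$, and add $v$ to $\mathcal{V}^{\text{known}}$. If $\|z^v\|>\epsilon$, set $\mathcal{P}^{\text{out}}_{k+1}=\mathcal{P}^{\text{out}}_k\cap\{y\mid (w^v)^{\mathsf T}y\ge (w^v)^{\mathsf T}\Gamma(x^v)\}$, $\mathcal{X}_{k+1}=\mathcal{X}_k$, increase $k$ by one, and immediately restart the main loop with the new $k$. Otherwise ($\|z^v\|\le\epsilon$), replace $\mathcal{X}_k$ by $\mathcal{X}_k\cup\{x^v\}$ and continue with the next vertex. If all vertices of $\mathcal{V}_k$ are gone through without a restart, terminate and return $\mathcal{X}_k$ (as the finite weak $\epsilon$-solution) together with $\mathcal{P}^{\text{out}}_k$ (an outer approximation of $\mathcal{P}$). *)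

(* Defs.v *)
From HB Require Import structures.
From mathcomp Require Import all_boot all_order all_algebra.
From mathcomp Require Import all_classical all_reals all_analysis.

Set Implicit Arguments.
Unset Strict Implicit.
Unset Printing Implicit Defensive.

Import Order.TTheory GRing.Theory Num.Theory.
Import numFieldNormedType.Exports.

Local Open Scope classical_set_scope.
Local Open Scope ring_scope.

(* Vectors of R^m are row vectors 'rV[R]_m. Topological
   notions (closure, interior, compactness, continuity) refer to the canonical
   product topology, which is the topology of every norm on R^m. *)

Section ConvexGeometry.
Context {R : realType} {q : nat}.
Local Notation V := 'rV[R]_q.
Implicit Types (N : V -> R) (A B C P : set V) (w y v : V).

Definition dot w y : R := (w *m y^T) 0 0.

Definition is_norm N : Prop :=
  [/\ forall y, 0 <= N y,
      forall y, N y = 0 -> y = 0,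
      forall (a : R) y, N (a *: y) = `|a| * N y
    & forall y1 y2, N (y1 + y2) <= N y1 + N y2].

Definition dual_norm N w : R := sup [set dot w y | y in [set y | N y <= 1]].

Definition norm_ball N (e : R) : set V := [set z | N z <= e].

Definition minkowski_sum A B : set V := [set a + b | a in A & b in B].

Definition halfspace w (b : R) : set V := [set y | b <= dot w y].

Definition polyhedral A : Prop :=
  exists (m : nat) (a : 'I_m -> V) (b : 'I_m -> R),
    A = \bigcap_(i : 'I_m) halfspace (a i) (b i).

Definition is_cone C : Prop :=
  forall (t : R) y, 0 <= t -> C y -> C (t *: y).

Definition solid C : Prop := C° !=set0.

Definition pointed C : Prop :=
  ~ exists y d, d != 0 /\ forall t : R, C (y + t *: d).

Definition nontrivial C : Prop := [set 0] `<` C /\ C `<` setT.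

Definition le_cone C y1 y2 : Prop := C (y2 - y1).

Definition dual_cone C : set V := [set w | forall y, C y -> 0 <= dot w y].

Definition conv_hull A : set V := smallest (@convex_set R V) A.

Definition cone_hull A : set V :=
  [set y | exists (t : R) a, [/\ 0 <= t, A a & y = t *: a]].

(* Extreme points; for a polyhedron these are its vertices. *)
Definition vertices P : set V :=
  [set v | P v /\ forall y1 y2 (t : R), P y1 -> P y2 -> 0 < t -> t < 1 ->
     v = t *: y1 + (1 - t) *: y2 -> y1 = v /\ y2 = v].

End ConvexGeometry.

Definition argmin_on {R : realType} {T : Type} (A : set T) (f : T -> R)
  : set T := [set a | A a /\ forall b, A b -> f a <= f b].

Definition argmax_on {R : realType} {T : Type} (A : set T) (f : T -> R)
  : set T := [set a | A a /\ forall b, A b -> f b <= f a].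

Section Problem.
Context {R : realType} {n q : nat}.
Variables (N : 'rV[R]_q -> R) (C : set 'rV[R]_q).
(* G is total for convenience: only its values on the feasible set S (and, in
   cone_convex, on its domain X) are ever used. *)
Variables (G : 'rV[R]_n -> 'rV[R]_q) (S : set 'rV[R]_n).

Definition cone_convex (X : set 'rV[R]_n) : Prop :=
  forall x1 x2 (t : R), X x1 -> X x2 -> 0 <= t -> t <= 1 ->
    le_cone C (G (t *: x1 + (1 - t) *: x2)) (t *: G x1 + (1 - t) *: G x2).

Definition upper_image : set 'rV[R]_q := closure (minkowski_sum (G @` S) C).

Definition weak_minimizer (x : 'rV[R]_n) : Prop :=
  S x /\ [set G x - c | c in C°] `&` (G @` S) = set0.

Definition finite_weak_solution (eps : R) (Xbar : set 'rV[R]_n) : Prop :=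
  [/\ Xbar !=set0, finite_set Xbar, Xbar `<=` S,
      forall x, Xbar x -> weak_minimizer x
    & upper_image `<=`
        minkowski_sum (minkowski_sum (conv_hull (G @` Xbar)) C) (norm_ball N eps)].

(* Optimal solutions of the weighted-sum scalarization WS(w), of the norm-
   minimizing scalarization P(v), and of its Lagrange dual D(v). *)
Definition WS_opt (w : 'rV[R]_q) : set 'rV[R]_n :=
  argmin_on S (fun x => dot w (G x)).

Definition P_opt (v : 'rV[R]_q) : set ('rV[R]_n * 'rV[R]_q) :=
  argmin_on [set xz | le_cone C (G xz.1 - xz.2 - v) 0 /\ S xz.1]
            (fun xz => N xz.2).

(* The real-valued inf is the true infimum: it is only used with S nonempty and
   compact and G continuous on S. Likewise for the sup in dual_norm. *)
Definition D_opt (v : 'rV[R]_q) : set 'rV[R]_q :=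
  argmax_on [set w | dual_norm N w <= 1 /\ dual_cone C w]
            (fun w => inf [set dot w (G x) | x in S] - dot w v).

(* In a configuration, X is the current set of collected feasible points, K the
   set of vertices already treated and P the current outer approximation of the
   upper image. [Loop] is the head of the main loop; in [Scan] the list holds
   the vertices of P that remain to be gone through in the current pass. The
   iteration counter is not stored: it is the number of [step_cut]s so far. *)
Inductive config : Type :=
| Loop of set 'rV[R]_n & set 'rV[R]_q & set 'rV[R]_q
| Scan of set 'rV[R]_n & set 'rV[R]_q & set 'rV[R]_q & seq 'rV[R]_q
| Done of set 'rV[R]_n & set 'rV[R]_q.

Variables (eps : R) (J : nat) (w : 'I_J -> 'rV[R]_q).

Inductive alg_init : config -> Prop :=
| init_intro (x : 'I_J -> 'rV[R]_n) :
    (forall j, WS_opt (w j) (x j)) ->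
    alg_init (Loop (range x) set0
      (\bigcap_(j : 'I_J) halfspace (w j) (dot (w j) (G (x j))))).

Inductive alg_step : config -> config -> Prop :=
| step_vertices X K P vs :
    uniq vs -> [set` vs] = vertices P ->
    alg_step (Loop X K P) (Scan X K P vs)
| step_skip X K P v vs :
    K v ->
    alg_step (Scan X K P (v :: vs)) (Scan X K P vs)
| step_cut X K P v vs x z u :
    ~ K v -> P_opt v (x, z) -> D_opt v u -> eps < N z ->
    alg_step (Scan X K P (v :: vs))
             (Loop X (v |` K) (P `&` halfspace u (dot u (G x))))
| step_add X K P v vs x z u :
    ~ K v -> P_opt v (x, z) -> D_opt v u -> N z <= eps ->
    alg_step (Scan X K P (v :: vs)) (Scan (x |` X) (v |` K) P vs)
| step_stop X K P :
    alg_step (Scan X K P [::]) (Done X P).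

Inductive alg_reach : config -> Prop :=
| reach_init c : alg_init c -> alg_reach c
| reach_step c c' : alg_reach c -> alg_step c c' -> alg_reach c'.

(* Some run of the algorithm terminates and returns the pair (Xbar, Pout). *)
Definition alg_returns (Xbar : set 'rV[R]_n) (Pout : set 'rV[R]_q) : Prop :=
  alg_reach (Done Xbar Pout).

End Problem.

(* Main.v *)
Require Import Defs.
From HB Require Import structures.
From mathcomp Require Import all_boot all_order all_algebra.
From mathcomp Require Import all_classical all_reals all_analysis.
From mathcomp Require Import ring lra.

Set Implicit Arguments.
Unset Strict Implicit.
Unset Printing Implicit Defensive.

Import Order.TTheory GRing.Theory Num.Theory.
Import numFieldNormedType.Exports.

Local Open Scope classical_set_scope.
Local Open Scope ring_scope.

(** Throughout a run of the algorithm the current outer approximation P is a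
polyhedron that contains Gamma(S) + C and whose recession cone lies in C, and
every collected point is a weak minimizer. At termination each vertex v of P is
covered, that is v + z lies in Gamma(x) + C for some collected x and some z of
norm at most eps. As P contains no line, it is the convex hull of its vertices
plus its recession cone ([polyhedron_sub]), so P, and hence the upper image,
lies in the convex set conv Gamma(Xbar) + C + B_eps.

The cuts preserve the inclusion of Gamma(S) + C because of strong duality
between P(v) and D(v) ([strong_duality]). If (x, z) solves P(v) and z is not 0,
the open norm ball of radius N z around v misses the convex set Gamma(S) + C;
separating them shows that the optimal value of D(v) is at least N z, and the
chain of inequalities of weak duality then collapses. So a solution u of D(v)
satisfies u . Gamma(x) = u . v + N z, and x minimizes u . Gamma over S. The first
fact says that the cut removes v, so that a vertex treated before is either
covered or gone for good; the second says that the cut is valid for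
Gamma(S) + C.

The same fact makes the collected x weak minimizers when z is not 0, since
minimizers of u . Gamma for a nonzero u in the dual cone are weak minimizers
([WS_weak_minimizer]). When z = 0 the dual solution may be 0 and gives nothing.
Then v itself lies in Gamma(x) + C, and if x were not a weak minimizer, v would
be an interior point of Gamma(S) + C, hence of P, which a vertex is not
([vertex_weak_minimizer]). *)

(** * The dot product *)

Section DotProduct.
Context {R : realType} {q : nat}.
Implicit Types (u w x y z : 'rV[R]_q) (t : R).

Lemma dotE w y : dot w y = \sum_j w 0 j * y 0 j.
Proof. by rewrite /dot mxE; apply: eq_bigr => j _; rewrite mxE. Qed.

Lemma dotC w y : dot w y = dot y w.
Proof. by rewrite !dotE; apply: eq_bigr => j _; rewrite mulrC. Qed.

Lemma dotDr w x y : dot w (x + y) = dot w x + dot w y.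
Proof. by rewrite /dot linearD/= mulmxDr mxE. Qed.

Lemma dotZr w t y : dot w (t *: y) = t * dot w y.
Proof. by rewrite /dot linearZ/= -scalemxAr mxE. Qed.

Lemma dotNr w y : dot w (- y) = - dot w y.
Proof. by rewrite -scaleN1r dotZr mulN1r. Qed.

Lemma dotBr w x y : dot w (x - y) = dot w x - dot w y.
Proof. by rewrite dotDr dotNr. Qed.

Lemma dot0r w : dot w 0 = 0.
Proof. by rewrite -(scale0r 0) dotZr mul0r. Qed.

Lemma dotZl w t y : dot (t *: w) y = t * dot w y.
Proof. by rewrite dotC dotZr dotC. Qed.

Lemma dotDl w x y : dot (w + x) y = dot w y + dot x y.
Proof. by rewrite dotC dotDr !(dotC y). Qed.

Lemma dot0l y : dot 0 y = 0.
Proof. by rewrite dotC dot0r. Qed.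

Lemma dot_ge0 y : 0 <= dot y y.
Proof. by rewrite dotE; apply: sumr_ge0 => j _; rewrite -expr2 sqr_ge0. Qed.

Lemma dot_gt0 y : y != 0 -> 0 < dot y y.
Proof.
move=> y0; rewrite lt_neqAle dot_ge0 andbT eq_sym.
apply: contra y0; rewrite dotE psumr_eq0 => [/allP y0|j _]; last first.
  by rewrite -expr2 sqr_ge0.
apply/eqP/rowP => j; rewrite mxE.
by have := y0 j (mem_index_enum _); rewrite /= mulf_eq0 orbb => /eqP.
Qed.

Lemma abs_coord_le_norm y j : `|y 0 j| <= `|y|.
Proof.
rewrite [leRHS]/Num.norm /= mx_normrE; apply/bigmax_geP; right => /=.
by exists (0, j).
Qed.

Lemma abs_dot_le_norm w y : `|dot w y| <= (\sum_j `|w 0 j|) * `|y|.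
Proof.
rewrite dotE (le_trans (ler_norm_sum _ _ _))// mulr_suml ler_sum// => j _.
by rewrite normrM ler_wpM2l// abs_coord_le_norm.
Qed.

Lemma continuous_dot w : continuous (dot w).
Proof.
suff : continuous (\sum_j (fun y : 'rV[R]_q => w 0 j * y 0 j)).
  rewrite (_ : \sum_j _ = dot w)//; apply/funext => y.
  by rewrite dotE fct_sumE; apply: eq_bigr.
move=> y.
elim/big_ind : _ => [|f g cf cg|j _]; first exact: cst_continuous.
  exact: continuousD.
by apply: continuousM; [exact: cst_continuous|exact: coord_continuous].
Qed.

Lemma continuous_dot_diag : continuous (fun y => dot y y).
Proof.
suff : continuous (\sum_j (fun y : 'rV[R]_q => y 0 j * y 0 j)).
  rewrite (_ : \sum_j _ = fun y => dot y y)//; apply/funext => y.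
  by rewrite dotE fct_sumE; apply: eq_bigr.
move=> y.
elim/big_ind : _ => [|f g cf cg|j _]; first exact: cst_continuous.
  exact: continuousD.
by apply: continuousM; exact: coord_continuous.
Qed.

Lemma closed_halfspace w t : closed (halfspace w t).
Proof.
apply: (@preimage_closed _ _ (dot w) _ _ (@closed_ge R t)) => y _.
exact: continuous_dot.
Qed.

End DotProduct.

(** * Norms and their duals *)

Lemma convex_setP {R : realType} {q : nat} (A : set 'rV[R]_q) :
  convex_set A <-> forall x y t, A x -> A y -> 0 <= t -> t <= 1 ->
    A (t *: x + (1 - t) *: y).
Proof.
split=> [cA x y t Ax Ay t0 t1|cA x y t /set_mem Ax /set_mem Ay].
  by have := cA x y (Itv01 t0 t1) (mem_set Ax) (mem_set Ay); rewrite inE.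
by apply/mem_set; apply: cA.
Qed.

Section Norm.
Context {R : realType} {q : nat}.
Variable N : 'rV[R]_q -> R.
Hypothesis normN : is_norm N.
Implicit Types (u y z : 'rV[R]_q).

Lemma is_norm_ge0 y : 0 <= N y. Proof. by case: normN. Qed.

Lemma is_norm0_eq0 y : N y = 0 -> y = 0. Proof. by case: normN => _ + _ _; exact. Qed.

Lemma is_normZ t y : N (t *: y) = `|t| * N y. Proof. by case: normN. Qed.

Lemma is_normD y z : N (y + z) <= N y + N z. Proof. by case: normN. Qed.

Lemma is_norm0 : N 0 = 0.
Proof. by rewrite -(scale0r 0) is_normZ normr0 mul0r. Qed.

Lemma is_normNr y : N (- y) = N y.
Proof. by rewrite -scaleN1r is_normZ normrN normr1 mul1r. Qed.

Lemma is_norm_gt0 y : y != 0 -> 0 < N y.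
Proof.
move=> y0; rewrite lt_neqAle is_norm_ge0 andbT eq_sym.
by apply: contra_neq y0 => /is_norm0_eq0.
Qed.

Lemma is_norm_dist y z : `|N y - N z| <= N (y - z).
Proof.
have ND a b : N a - N b <= N (a - b) by rewrite lerBlDr -{1}(subrK b a) is_normD.
by rewrite ler_norml ND andbT lerNl opprB -(is_normNr (y - z)) opprB ND.
Qed.

Lemma is_norm_le_norm y : N y <= (\sum_j N (delta_mx 0 j)) * `|y|.
Proof.
rewrite [in N _](row_sum_delta y) mulr_suml.
elim/big_ind2 : _ => [|y1 t1 y2 t2 le1 le2|j _].
- by rewrite is_norm0.
- by rewrite (le_trans (is_normD _ _))// lerD.
- by rewrite is_normZ mulrC ler_wpM2l ?is_norm_ge0// abs_coord_le_norm.
Qed.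

Lemma continuous_is_norm : continuous N.
Proof.
move=> y; apply/(@cvgrPdist_lt R R^o _ _ (nbhs_filter y)) => e e0.
pose M := 1 + \sum_j N (delta_mx 0 j).
have M0 : 0 < M by rewrite ltr_pwDl// sumr_ge0// => j _; exact: is_norm_ge0.
have NM z : N z <= M * `|z|.
  by rewrite (le_trans (is_norm_le_norm z))// ler_wpM2r// lerDr.
have ltNe z : `|y - z| < e / M -> `|N y - N z| < e.
  rewrite ltr_pdivlMr// mulrC => /(le_lt_trans (NM _)); apply: le_lt_trans.
  exact: is_norm_dist.
apply/(@nbhs_normP R 'rV[R]_q); exists (e / M); first by rewrite /= divr_gt0.
by move=> z /= /ltNe.
Qed.

(** All norms are equivalent: N attains a positive minimum c on the unit sphere of
the canonical norm, which is compact. The sphere is empty when [q = 0]. *)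
Lemma is_norm_ge_norm : exists2 c : R, 0 < c & forall y, c * `|y| <= N y.
Proof.
have [sphere0|sphere0] := pselect ([set y : 'rV[R]_q | `|y| = 1] !=set0).
  have sphere_compact : compact [set y : 'rV[R]_q | `|y| = 1].
    apply: bounded_closed_compact.
      exists 1; split; first exact: num_real.
      by move=> M M1 y /= ->; exact: ltW.
    have := @preimage_closed 'rV[R]_q R Num.norm [set x | x = 1].
    by apply; [move=> y _; exact: norm_continuous|exact: closed_eq].
  have [c] := EVT_min_rV sphere0 sphere_compact
    (continuous_subspaceT continuous_is_norm).
  rewrite inE /= => c1 cN; exists (N c).
    by rewrite is_norm_gt0// -normr_gt0 c1.
  move=> y; have [->|y0] := eqVneq y 0; first by rewrite normr0 mulr0 is_norm_ge0.
  have ny0 : 0 < `|y| by rewrite normr_gt0.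
  have := cN (`|y|^-1 *: y).
  rewrite inE /= normrZ normfV normr_id mulVf ?gt_eqF// => /(_ erefl).
  by rewrite is_normZ normfV normr_id mulrC ler_pdivlMr.
exists 1 => // y; have [->|y0] := eqVneq y 0.
  by rewrite normr0 mulr0 is_norm_ge0.
exfalso; apply: sphere0; exists (`|y|^-1 *: y) => /=.
by rewrite normrZ normfV normr_id mulVf// normr_eq0.
Qed.

(** Without this bound the real-valued supremum in [dual_norm] would be a default
value; equivalence of norms makes the unit ball of N bounded. *)
Lemma has_ubound_dual_norm u : has_ubound [set dot u y | y in [set y | N y <= 1]].
Proof.
have [c c0 cN] := is_norm_ge_norm.
exists ((\sum_j `|u 0 j|) * c^-1) => _ [y /= Ny1 <-].
rewrite (le_trans (ler_norm _))// (le_trans (abs_dot_le_norm _ _))//.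
rewrite ler_wpM2l ?sumr_ge0// -(ler_pM2l c0) divff ?gt_eqF//.
by rewrite (le_trans (cN y)).
Qed.

Lemma dot_le_dual_norm u z : dot u z <= dual_norm N u * N z.
Proof.
have [->|z0] := eqVneq z 0; first by rewrite dot0r is_norm0 mulr0.
have Nz0 := is_norm_gt0 z0.
rewrite -ler_pdivrMr// mulrC -dotZr; apply: ub_le_sup.
  exact: has_ubound_dual_norm.
exists ((N z)^-1 *: z) => //=.
by rewrite is_normZ ger0_norm ?invr_ge0 ?is_norm_ge0// mulVf// gt_eqF.
Qed.

Lemma dual_norm_gt0 u : u != 0 -> 0 < dual_norm N u.
Proof.
move=> u0; have := lt_le_trans (dot_gt0 u0) (dot_le_dual_norm u u).
by rewrite pmulr_lgt0// is_norm_gt0.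
Qed.

End Norm.

(** * Separation of a convex set from a norm ball *)

Lemma closure_le_fun {R : realType} {q : nat} (f : 'rV[R]_q -> R) (D : set 'rV[R]_q) (r : R) :
  continuous f -> (forall y, D y -> r <= f y) -> forall y, closure D y -> r <= f y.
Proof.
move=> cf Df y; rewrite closureE; apply: smallest_sub Df y.
have := @preimage_closed 'rV[R]_q R f [set x | r <= x].
by apply; [move=> z _; exact: cf|exact: closed_ge].
Qed.

(** The minimizer p of the Euclidean norm over the closure of D is the normal
vector. If p . (d - p) were negative for some d in D, moving from p a little
towards d would decrease the norm. *)
Lemma separation {R : realType} {q : nat} (D : set 'rV[R]_q) :
  convex_set D -> D !=set0 -> ~ closure D 0 ->
  exists w c, 0 < c /\ forall d, D d -> c <= dot w d.
Proof.
move=> /convex_setP cD [d0 Dd0] D0.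
(* Cutting D at the norm of one of its points makes it compact. *)
pose A := closure D `&` [set y | dot y y <= dot d0 d0].
have Ad0 : A d0 by split; [exact: subset_closure|rewrite /= lexx].
have bA : bounded_set A.
  exists (1 + dot d0 d0); split; first exact: num_real.
  move=> M ltM y [_ /= yd0]; rewrite (le_trans _ (ltW ltM))//.
  rewrite [leLHS]/Num.norm /= mx_normrE; apply/bigmax_leP; split.
    by rewrite addr_ge0// dot_ge0.
  move=> [i j] _ /=; rewrite (ord1 i).
  have : `|y 0 j| ^+ 2 <= dot y y.
    rewrite real_normK ?num_real// dotE (bigD1 j)//= -expr2 lerDl sumr_ge0// => k _.
    by rewrite -expr2 sqr_ge0.
  move/le_trans/(_ yd0) => yj.
  have [y1|/ltW y1] := leP `|y 0 j| 1; first by rewrite (le_trans y1)// lerDl dot_ge0.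
  rewrite (@le_trans _ _ (dot d0 d0))//; last by rewrite lerDr.
  by apply: le_trans yj; rewrite expr2 ler_peMr.
have cA : compact A.
  apply: bounded_closed_compact => //; apply: closedI; first exact: closed_closure.
  have := @preimage_closed 'rV[R]_q R (fun y => dot y y) [set x | x <= dot d0 d0].
  by apply; [move=> y _; exact: continuous_dot_diag|exact: closed_le].
have [p] := EVT_min_rV (ex_intro _ d0 Ad0) cA
  (continuous_subspaceT continuous_dot_diag).
rewrite inE => -[Dp pd0] pmin.
have {}pmin y : closure D y -> dot p p <= dot y y.
  move=> Dy; have [yd0|/ltW yd0] := leP (dot y y) (dot d0 d0).
    by apply: pmin; rewrite inE; split.
  exact: le_trans yd0.
have p0 : p != 0 by apply/eqP => p0; apply: D0; rewrite -p0.
exists p, (dot p p); split; first exact: dot_gt0.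
move=> d Dd; rewrite -subr_ge0 -dotBr leNgt; apply/negP.
set a := dot p (d - p) => a0.
set b := dot (d - p) (d - p).
have b0 : 0 <= b by exact: dot_ge0.
have seg t : 0 < t -> t <= 1 -> 0 <= 2 * a + t * b.
  move=> t0 t1.
  have Dt : closure D (p + t *: (d - p)).
    have -> : p + t *: (d - p) = (1 - t) *: p + t *: d.
      by rewrite scalerBr scalerBl scale1r addrA addrAC.
    have cf : continuous (fun y : 'rV[R]_q => (1 - t) *: y + t *: d).
      move=> y; apply: continuousD; first exact: scaler_continuous.
      exact: cst_continuous.
    suff : closure D `<=` (fun y => (1 - t) *: y + t *: d) @^-1` closure D by exact.
    rewrite [X in X `<=` _]closureE; apply: smallest_sub.
      have := @preimage_closed 'rV[R]_q 'rV[R]_q (fun y => (1 - t) *: y + t *: d) (closure D).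
      by apply; [move=> y _; exact: cf|exact: closed_closure].
    move=> y Dy; apply: subset_closure.
    have := cD d y t Dd Dy (ltW t0) t1.
    by rewrite addrC.
  have := pmin _ Dt; rewrite dotDr !dotDl !dotZr !dotZl.
  rewrite -/b (dotC (d - p) p) -/a -addrA lerDl.
  have -> : t * a + (t * a + t * (t * b)) = t * (2 * a + t * b) by ring.
  by rewrite pmulr_rge0.
have ba0 : 0 < b - a by rewrite subr_gt0 (lt_le_trans a0).
(* At this parameter the quadratic 2 a t + t^2 b is negative. *)
have t1 : - a / (b - a) <= 1 by rewrite ler_pdivrMr// mul1r lerDr.
have t0 : 0 < - a / (b - a) by rewrite divr_gt0// oppr_gt0.
have := seg _ t0 t1.
have -> : 2 * a + - a / (b - a) * b = a * (1 + - a / (b - a)).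
  by field; rewrite gt_eqF.
by rewrite leNgt nmulr_rlt0// addr_gt0.
Qed.

(** A set at N-distance at least r from v is kept at positive distance from the
ball of radius s < r around v, so the Minkowski difference of the two has 0
outside its closure and [separation] applies. Taking the supremum of the
separating functional over the ball produces its dual norm, by which it is then
normalized. Radii s < r are enough to bound a supremum below by r, which is all
that [strong_duality] asks for, and they spare a limit argument. *)
Lemma norm_separation {R : realType} {q : nat} (N : 'rV[R]_q -> R)
    (F : set 'rV[R]_q) v (r s : R) :
  is_norm N -> convex_set F -> F !=set0 -> (forall p, F p -> r <= N (p - v)) ->
  0 <= s -> s < r ->
  exists u, dual_norm N u <= 1 /\ forall p, F p -> s <= dot u (p - v).
Proof.
move=> normN /convex_setP cF [p0 Fp0] rF s0 sr.
(* The difference between F and the closed N-ball of radius s around v. *)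
pose D := [set d | exists2 p, F p & N (p - v - d) <= s].
have cD : convex_set D.
  apply/convex_setP => x y t [p Fp px] [p' Fp' py] t0 t1.
  exists (t *: p + (1 - t) *: p'); first exact: cF.
  have -> : t *: p + (1 - t) *: p' - v - (t *: x + (1 - t) *: y) =
      t *: (p - v - x) + (1 - t) *: (p' - v - y).
    by apply/rowP => j; rewrite !mxE; ring.
  rewrite (le_trans (is_normD normN _ _))// !is_normZ// !ger0_norm ?subr_ge0//.
  have -> : s = t * s + (1 - t) * s by ring.
  by rewrite lerD// ler_wpM2l// subr_ge0.
have ND y : closure D y -> r - s <= N y.
  apply: closure_le_fun; first exact: continuous_is_norm.
  move=> d [p Fp pd]; rewrite lerBlDr (le_trans (rF _ Fp))//.
  by rewrite -[p - v](subrK d) (le_trans (is_normD normN _ _))// addrC lerD2l.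
have [|||w [c [c0 wc]]] := @separation _ _ D => //.
- by exists (p0 - v), p0 => //; rewrite subrr is_norm0.
- by move=> /ND; rewrite is_norm0// leNgt subr_gt0 sr.
have wF p y : F p -> N y <= s -> c <= dot w (p - v) - dot w y.
  move=> Fp ys; rewrite -dotBr; apply: wc; exists p => //.
  by rewrite opprB addrCA subrr addr0.
have w0 : w != 0.
  apply/eqP => w0; have := wF p0 0 Fp0; rewrite is_norm0// w0 !dot0l subrr.
  by move=> /(_ s0); rewrite leNgt c0.
have b0 := dual_norm_gt0 normN w0.
exists ((dual_norm N w)^-1 *: w); split.
  apply: ge_sup; first by exists (dot ((dual_norm N w)^-1 *: w) 0), 0 => //=; rewrite is_norm0.
  move=> _ [y /= y1 <-]; rewrite dotZl mulrC ler_pdivrMr// mul1r.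
  by rewrite (le_trans (dot_le_dual_norm normN w y))// ler_piMr// ltW.
move=> p Fp; rewrite dotZl mulrC ler_pdivlMr//.
have [->|sn0] := eqVneq s 0.
  have := wF p 0 Fp; rewrite is_norm0// dot0r subr0 mul0r => /(_ s0).
  by apply: le_trans; exact: ltW.
have sp : 0 < s by rewrite lt_neqAle eq_sym sn0.
rewrite mulrC -ler_pdivlMr//; apply: ge_sup.
  by exists (dot w 0), 0 => //=; rewrite is_norm0.
move=> _ [y /= y1 <-]; rewrite ler_pdivlMr// mulrC -dotZr.
have : N (s *: y) <= s by rewrite is_normZ// gtr0_norm// ler_piMr.
by move=> /(wF _ _ Fp)/(le_trans (ltW c0)); rewrite subr_ge0.
Qed.

(** * Polyhedra without lines *)

Section Polyhedron.
Context {R : realType} {q : nat} {I : finType}.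
Variables (a : I -> 'rV[R]_q) (b : I -> R).
Implicit Types (y d : 'rV[R]_q).

Let P : set 'rV[R]_q := \bigcap_i halfspace (a i) (b i).

Definition inactive y : {set I} := [set i | b i < dot (a i) y]%SET.

(** Follow the ray from y until the first constraint becomes tight. The constraints
that are tight at y stay so, which makes the number of inactive ones decrease. *)
Lemma ray_leaves_polyhedron y d : P y ->
    (forall i, i \notin inactive y -> dot (a i) d = 0) ->
    (exists i, dot (a i) d < 0) ->
  exists t, [/\ 0 < t, P (y + t *: d) & inactive (y + t *: d) \proper inactive y].
Proof.
move=> Py active0 [i0 di0].
(* f i is the time at which the ray reaches the hyperplane of constraint i. *)
pose f i := (dot (a i) y - b i) / - dot (a i) d.
have := @Order.TotalTheory.arg_minP _ _ I i0 (fun i => dot (a i) d < 0) f di0.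
case=> i di fi.
have inacti : i \in inactive y.
  by apply: contraTT di => /active0 ->; rewrite ltxx.
have f0 : 0 < f i.
  by rewrite divr_gt0 ?oppr_gt0// subr_gt0; move: inacti; rewrite inE.
exists (f i); split=> //.
  move=> j _; rewrite /halfspace /= dotDr dotZr.
  have [dj|dj] := ltP (dot (a j) d) 0.
    by have := fi j dj; rewrite ler_pdivlMr ?oppr_gt0// mulrN; lra.
  by rewrite (le_trans (Py j Logic.I))// lerDl mulr_ge0// ltW.
apply/properP; split.
  apply/fintype.subsetP => j; apply: contraTT => jy; move: (jy).
  by rewrite !inE dotDr dotZr (active0 _ jy) mulr0 addr0.
exists i => //; rewrite inE dotDr dotZr /f invrN mulrN mulNr divfK ?lt_eqF//.
by rewrite opprB addrC subrK ltxx.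
Qed.

(** The part of the Minkowski-Weyl theorem that the algorithm relies on: a
polyhedron without lines is contained in every convex set that contains its
vertices and is stable under its recession directions. By induction on the number
of inactive constraints at y: if y is not a vertex, it lies inside a segment of
the polyhedron, along whose line the tight constraints stay tight. Going both ways
along this line, one either hits a new constraint on each side, and y is a convex
combination of the two hitting points, or one direction is a recession direction
and y is reached from the hitting point on the other side. *)
Lemma polyhedron_sub (T : set 'rV[R]_q) :
    (forall d, (forall i, 0 <= dot (a i) d) -> (forall i, 0 <= dot (a i) (- d)) ->
       d = 0) ->
    convex_set T -> vertices P `<=` T ->
    (forall y d, T y -> (forall i, 0 <= dot (a i) d) -> T (y + d)) ->
  P `<=` T.
Proof.
move=> noline /convex_setP cT vT recT y.
have [m] := ubnP #|inactive y|; elim: m y => // m IH y ym Py.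
have [/vT//|nvy] := pselect (vertices P y).
have [y1 [y2 [t [Py1 [Py2 [t0 [t1 [yE y12]]]]]]]] : exists y1 y2 t, P y1 /\ P y2 /\
    0 < t /\ t < 1 /\ y = t *: y1 + (1 - t) *: y2 /\ y1 <> y2.
  apply: contra_notP nvy => /forallNP nvy; split=> // y1 y2 t Py1 Py2 t0 t1 yE.
  have y12 : y1 = y2.
    apply: contra_notP (nvy y1) => y12.
    by exists y2, t.
  by rewrite yE y12 -scalerDl addrC subrK scale1r.
have active0 i : i \notin inactive y -> dot (a i) (y1 - y2) = 0.
  rewrite inE -leNgt dotBr {1}yE dotDr !dotZr.
  have := Py1 i Logic.I; have := Py2 i Logic.I; rewrite /halfspace /=.
  by move: (dot (a i) y1) (dot (a i) y2) => e1 e2 ? ? ?; nra.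
have active0N i : i \notin inactive y -> dot (a i) (- (y1 - y2)) = 0.
  by move=> /active0; rewrite dotNr => ->; rewrite oppr0.
have decr d t' : inactive (y + t' *: d) \proper inactive y ->
    P (y + t' *: d) -> T (y + t' *: d).
  by move=> /proper_card lt; apply: IH; exact: leq_trans lt _.
have back d t' : 0 <= t' -> (forall i, 0 <= dot (a i) d) -> T (y + t' *: - d) -> T y.
  move=> t'0 d0 /recT => /(_ (t' *: d)).
  by rewrite scalerN subrK; apply=> i; rewrite dotZr mulr_ge0.
have [ex1|nex1] := pselect (exists i, dot (a i) (y1 - y2) < 0); last first.
  have rec1 i : 0 <= dot (a i) (y1 - y2).
    by rewrite leNgt; apply/negP => di; apply: nex1; exists i.
  have [/(ray_leaves_polyhedron Py active0N)[s [s0 Ps sy]]|nex2] :=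
      pselect (exists i, dot (a i) (- (y1 - y2)) < 0).
    by apply: (back (y1 - y2) s); [exact: ltW| |exact: decr].
  exfalso; apply: y12; apply/eqP; rewrite -subr_eq0; apply/eqP/noline => // i.
  by rewrite leNgt; apply/negP => di; apply: nex2; exists i.
have [s [s0 Ps sy]] := ray_leaves_polyhedron Py active0 ex1.
have [/(ray_leaves_polyhedron Py active0N)[r [r0 Pr ry]]|nex2] :=
    pselect (exists i, dot (a i) (- (y1 - y2)) < 0); last first.
  apply: (back (- (y1 - y2)) s); first exact: ltW.
    by move=> i; rewrite leNgt; apply/negP => di; apply: nex2; exists i.
  by rewrite opprK; exact: decr.
have sr0 : 0 < s + r by rewrite addr_gt0.
have -> : y = (r / (s + r)) *: (y + s *: (y1 - y2)) +
    (1 - r / (s + r)) *: (y + r *: - (y1 - y2)).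
  by apply/rowP => j; rewrite !mxE; field; rewrite gt_eqF.
apply: cT; [exact: decr|exact: decr|by rewrite divr_ge0// ltW|].
by rewrite ler_pdivrMr// mul1r lerDr ltW.
Qed.

End Polyhedron.

(** * Cones and scalarizations *)

Section Cone.
Context {R : realType} {q : nat}.
Variable C : set 'rV[R]_q.
Implicit Types (u c d y : 'rV[R]_q).

Lemma cone_add c d : convex_set C -> is_cone C -> C c -> C d -> C (c + d).
Proof.
move=> /convex_setP convC coneC Cc Cd.
have -> : c + d = 2 *: (2^-1 *: c + (1 - 2^-1) *: d).
  by apply/rowP => j; rewrite !mxE; field.
by apply: coneC => //; apply: convC => //; lra.
Qed.

Lemma interior_two_sided c d : C° c -> exists t : R, [/\ 0 < t, C (c + t *: d) & C (c - t *: d)].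
Proof.
move=> /(@nbhs_normP R 'rV[R]_q)[e /= e0 eC].
have d0 : 0 < 1 + `|d| by rewrite ltr_pwDl.
have t0 : 0 < e / (1 + `|d|) by rewrite divr_gt0.
have lte : `|(e / (1 + `|d|)) *: d| < e.
  by rewrite normrZ gtr0_norm// mulrAC ltr_pdivrMr// ltr_pM2l// ltrDr.
exists (e / (1 + `|d|)); split=> //; apply: eC => /=.
  by rewrite opprD addrA subrr sub0r normrN.
by rewrite opprB addrCA subrr addr0.
Qed.

Lemma dual_cone_interior_gt0 u c : dual_cone C u -> u != 0 -> C° c -> 0 < dot u c.
Proof.
move=> Cu u0 /(interior_two_sided u)[t [t0 _ /Cu]].
rewrite dotBr dotZr subr_ge0; apply: lt_le_trans.
by rewrite mulr_gt0// dot_gt0.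
Qed.

(** C is its own bidual: since C is a cone, the normals of the halfspaces that
define it lie in the dual cone and their offsets are at most 0. *)
Lemma polyhedral_bipolar d : polyhedral C -> is_cone C ->
  (forall u, dual_cone C u -> 0 <= dot u d) -> C 0 -> C d.
Proof.
move=> [m [a [b CE]]] coneC ud C0.
have b0 i : b i <= 0 by move: C0; rewrite CE => /(_ i Logic.I); rewrite /halfspace /= dot0r.
rewrite CE => i _; rewrite /halfspace /= (le_trans (b0 i))//; apply: ud => y Cy.
rewrite leNgt; apply/negP => ay.
(* Scaling y by this factor would bring it to the level b i - 1. *)
have t0 : 0 <= (b i - 1) / dot (a i) y.
  by rewrite mulr_le0// ?invr_le0 ?(ltW ay)// subr_le0 (le_trans (b0 i)).
have := coneC _ _ t0 Cy; rewrite {1}CE => /(_ i Logic.I).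
by rewrite /halfspace /= dotZr divfK ?lt_eqF//; lra.
Qed.

End Cone.

Section Scalarization.
Context {R : realType} {n q : nat}.
Variables (N : 'rV[R]_q -> R) (C : set 'rV[R]_q) (G : 'rV[R]_n -> 'rV[R]_q).
Variables (X S : set 'rV[R]_n).
Hypotheses (normN : is_norm N) (convC : convex_set C) (coneC : is_cone C).
Hypotheses (C0 : C 0) (convG : cone_convex C G X) (contG : {within X, continuous G}).
Hypotheses (subSX : S `<=` X) (compactS : compact S) (convS : convex_set S).
Hypothesis S0 : S !=set0.

Let F := minkowski_sum (G @` S) C.

(** This is where C-convexity of G enters: it puts the defect of G against a chord
into C. *)
Lemma image_plus_cone_convex : convex_set F.
Proof.
apply/convex_setP => _ _ t [_ [x1 Sx1 <-] [c1 Cc1 <-]] [_ [x2 Sx2 <-] [c2 Cc2 <-]] t0 t1.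
have t10 : 0 <= 1 - t by rewrite subr_ge0.
set x := t *: x1 + (1 - t) *: x2.
exists (G x); first by exists x => //; move/convex_setP : convS; apply.
exists ((t *: G x1 + (1 - t) *: G x2 - G x) + (t *: c1 + (1 - t) *: c2)).
  apply: cone_add => //; first by apply: convG => //; exact: subSX.
  by apply: cone_add => //; exact: coneC.
by apply/rowP => j; rewrite !mxE; ring.
Qed.

(** A point whose image dominates that of x by an interior element of C would have a
smaller weighted sum. *)
Lemma WS_weak_minimizer u x :
  dual_cone C u -> u != 0 -> WS_opt G S u x -> weak_minimizer C G S x.
Proof.
move=> Cu u0 [Sx xmin]; split=> //.
apply/seteqP; split=> // _ [[c Cc <-] [x' /xmin]] /[swap] ->.
rewrite dotBr => le_x; have := dual_cone_interior_gt0 Cu u0 Cc.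
by move=> c0; exfalso; lra.
Qed.

(** Without this bound the real-valued infimum in [D_opt] would be a default value. *)
Lemma has_lbound_WS u : has_lbound [set dot u (G x) | x in S].
Proof.
have cuG : {within S, continuous (dot u \o G)}.
  apply: within_continuous_comp; first by move=> y _; exact: continuous_dot.
  exact: (continuous_subspaceW subSX contG).
have [x _ xmin] := EVT_min_rV S0 compactS cuG.
by exists (dot u (G x)) => _ [x' Sx' <-]; apply: xmin; rewrite inE.
Qed.

(** A functional that is bounded below on a translate of the cone C cannot be
negative on C. *)
Lemma bounded_below_dual_cone u v s :
  (forall p, F p -> s <= dot u (p - v)) -> dual_cone C u.
Proof.
move=> sF c Cc; rewrite leNgt; apply/negP => uc.
have [x0 Sx0] := S0.
have FG c' : C c' -> F (G x0 + c') by move=> ?; exists (G x0); [exists x0|exists c'].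
(* Where the functional drops to s - 1 along the ray from G x0 - v in direction c. *)
pose t := (s - 1 - dot u (G x0 - v)) / dot u c.
have t0 : 0 <= t.
  have := sF _ (FG 0 C0); rewrite addr0 => ?.
  by rewrite /t mulr_le0// ?invr_le0 ?(ltW uc)//; lra.
have := sF _ (FG _ (coneC t0 Cc)).
by rewrite addrAC dotDr dotZr divfK ?lt_eqF//; lra.
Qed.

(** Separation bounds the optimal value of D(v) from below by every s < N z, hence
by N z, while u . G x - u . v <= u . z <= N z because x and z are feasible and u has
dual norm at most 1. So all these inequalities are equalities. *)
Lemma strong_duality v x z u : P_opt N C G S v (x, z) -> D_opt N C G S v u -> 0 < N z ->
  WS_opt G S u x /\ dot u (G x) = dot u v + N z.
Proof.
move=> [[/= Cxz Sx] zmin] [[u1 Cu] umax] z0.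
have zF p : F p -> N z <= N (p - v).
  move=> [_ [x' Sx' <-] [c Cc <-]].
  have := zmin (x', G x' + c - v); apply; split=> //=.
  by rewrite /le_cone (_ : 0 - _ = c)//; apply/rowP => j; rewrite !mxE; ring.
have F0 : F !=set0.
  by exists (G x + 0); exists (G x); [exists x|exists 0].
have dual_ge : N z <= inf [set dot u (G x) | x in S] - dot u v.
  rewrite leNgt; apply/negP => ltz.
  (* Strictly between the dual value and N z, but nonnegative so as to be a radius. *)
  pose s := Num.max 0 (((inf [set dot u (G x) | x in S] - dot u v) + N z) / 2).
  have s0 : 0 <= s by rewrite le_max lexx.
  have sz : s < N z by rewrite gt_max z0 /=; lra.
  have [u' [u'1 u's]] := norm_separation normN image_plus_cone_convex F0 zF s0 sz.
  have Cu' := bounded_below_dual_cone u's.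
  have := umax u' (conj u'1 Cu').
  suff : s + dot u' v <= inf [set dot u' (G x) | x in S].
    have : ((inf [set dot u (G x) | x in S] - dot u v) + N z) / 2 <= s.
      by rewrite le_max lexx orbT.
    lra.
  apply: lb_le_inf; first by exists (dot u' (G x)), x.
  move=> _ [x' Sx' <-]; rewrite -lerBrDr -dotBr; apply: u's.
  by exists (G x'); [exists x'|exists 0; rewrite ?addr0].
have infS x' : S x' -> inf [set dot u (G x) | x in S] <= dot u (G x').
  by move=> Sx'; apply: ge_inf; [exact: has_lbound_WS|exists x'].
have weak : dot u (G x) <= dot u v + N z.
  have := Cu _ Cxz; rewrite sub0r dotNr !dotBr.
  have := dot_le_dual_norm normN u z.
  have : dual_norm N u * N z <= N z by rewrite ler_piMl// ltW.
  lra.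
split.
  by split=> // x' /infS; lra.
by apply/eqP; rewrite eq_le weak /=; have := infS _ Sx; lra.
Qed.

(** The dual solution u is nonzero because the optimal value N z is. *)
Lemma P_opt_weak_minimizer v x z u : P_opt N C G S v (x, z) -> D_opt N C G S v u ->
  0 < N z -> weak_minimizer C G S x.
Proof.
move=> Pxz Du z0; have [WSx ux] := strong_duality Pxz Du z0.
case: Du => -[_ Cu] _; apply: WS_weak_minimizer Cu _ WSx.
by apply: contraTneq z0 => u0; move: ux; rewrite u0 !dot0l add0r => <-; rewrite ltxx.
Qed.

(** If G x' = G x - c0 with c0 interior to C, then v = G x' + c0 + (v - G x) is the
midpoint of two distinct points of G S + C obtained by moving c0 a little both ways
along any nonzero direction. This contradicts that v is an extreme point of P. *)
Lemma vertex_weak_minimizer P v x : (0 < q)%N -> F `<=` P -> vertices P v ->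
  S x -> C (v - G x) -> weak_minimizer C G S x.
Proof.
move=> q0 FP [Pv extv] Sx Cv; split=> //; apply/seteqP; split=> // _ [[c0 Cc0 <-] [x' Sx' x'E]].
pose d : 'rV[R]_q := const_mx 1.
have [t [t0 Cp Cm]] := interior_two_sided d Cc0.
have Fc c : C c -> P (G x - c0 + c + (v - G x)).
  move=> Cc; apply: FP; exists (G x'); first by exists x'.
  by exists (c + (v - G x)); [exact: cone_add|rewrite x'E addrA].
have [half_gt0 half_lt1] : 0 < 2^-1 :> R /\ 2^-1 < 1 :> R by split; lra.
have [|+ _] := extv _ _ _ (Fc _ Cp) (Fc _ Cm) half_gt0 half_lt1.
  by apply/rowP => j; rewrite !mxE; field.
move/rowP/(_ (Ordinal q0)); rewrite !mxE mulr1; lra.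
Qed.

End Scalarization.

(** * Invariant of the algorithm *)

Section ConvexSets.
Context {R : realType} {q : nat}.
Implicit Types A B : set 'rV[R]_q.

Lemma convex_conv_hull A : convex_set (conv_hull A).
Proof.
apply/convex_setP => x y t Ax Ay t0 t1 B [cB AB].
by move/convex_setP: (cB); apply=> //; [exact: Ax|exact: Ay].
Qed.

Lemma convex_minkowski_sum A B :
  convex_set A -> convex_set B -> convex_set (minkowski_sum A B).
Proof.
move=> /convex_setP cA /convex_setP cB; apply/convex_setP.
move=> _ _ t [a Aa [b Bb <-]] [a' Aa' [b' Bb' <-]] t0 t1.
exists (t *: a + (1 - t) *: a'); first exact: cA.
exists (t *: b + (1 - t) *: b'); first exact: cB.
by rewrite !scalerDr addrACA.
Qed.

Lemma convex_norm_ball (N : 'rV[R]_q -> R) e : is_norm N -> convex_set (norm_ball N e).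
Proof.
move=> normN; apply/convex_setP => x y t; rewrite /norm_ball /= => xe ye t0 t1.
rewrite (le_trans (is_normD normN _ _))// !is_normZ// !ger0_norm ?subr_ge0//.
have -> : e = t * e + (1 - t) * e by ring.
by rewrite lerD// ler_wpM2l// subr_ge0.
Qed.

(** The condition 0 <= u . d on u is preserved by convex and conic combinations. *)
Lemma dual_cone_generators_ge0 {J : nat} (C : set 'rV[R]_q) (w : 'I_J -> 'rV[R]_q) d :
  dual_cone C = conv_hull (cone_hull (range w)) -> (forall j, 0 <= dot (w j) d) ->
  forall u, dual_cone C u -> 0 <= dot u d.
Proof.
move=> -> wd; apply: smallest_sub.
  apply/convex_setP => x y t xd yd t0 t1; rewrite /= dotDl !dotZl.
  by rewrite addr_ge0// mulr_ge0// subr_ge0.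
by move=> _ [t [_ [t0 [j _ <-] ->]]] /=; rewrite dotZl mulr_ge0.
Qed.

Lemma dual_cone_generator {J : nat} (C : set 'rV[R]_q) (w : 'I_J -> 'rV[R]_q) j :
  dual_cone C = conv_hull (cone_hull (range w)) -> dual_cone C (w j).
Proof.
move=> ->; apply: sub_gen_smallest; exists 1, (w j).
by split; [exact: ler01|exists j|rewrite scale1r].
Qed.

(** The dual cone contains 0, while the convex hull of the empty set is empty. *)
Lemma generators_nonempty {J : nat} (C : set 'rV[R]_q) (w : 'I_J -> 'rV[R]_q) :
  dual_cone C = conv_hull (cone_hull (range w)) -> inhabited 'I_J.
Proof.
move=> genC; apply: contrapT => J0.
have : dual_cone C 0 by move=> y _; rewrite dot0l.
rewrite genC; suff : conv_hull (cone_hull (range w)) `<=` set0 by apply.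
apply: smallest_sub; first by apply/convex_setP => x y t [].
by move=> y [t [a [_ [j _ _] _]]]; apply: J0; exists.
Qed.

End ConvexSets.

Section Invariant.
Context {R : realType} {n q : nat}.
Variables (N : 'rV[R]_q -> R) (C : set 'rV[R]_q) (G : 'rV[R]_n -> 'rV[R]_q).
Variables (S : set 'rV[R]_n) (eps : R).

Definition covered (X : set 'rV[R]_n) v :=
  exists x z, [/\ X x, N z <= eps & C (v + z - G x)].

(** The polyhedra are indexed by an arbitrary finite type so that adding a
halfspace amounts to passing from I to [option I]. *)
Definition outer_polyhedron (P : set 'rV[R]_q) :=
  exists (I : finType) (a : I -> 'rV[R]_q) (b : I -> R),
    [/\ P = \bigcap_i halfspace (a i) (b i),
        forall d, (forall i, 0 <= dot (a i) d) -> C d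
      & minkowski_sum (G @` S) C `<=` P].

Definition finite_minimizers (X : set 'rV[R]_n) :=
  [/\ X !=set0, finite_set X & X `<=` weak_minimizer C G S].

(** A vertex treated earlier that was cut off is never a vertex again, so the set K
only needs to be controlled inside P. *)
Definition alg_invariant (c : config) : Prop :=
  match c with
  | Loop X K P => [/\ finite_minimizers X, outer_polyhedron P
      & forall v, K v -> P v -> covered X v]
  | Scan X K P vs => [/\ finite_minimizers X, outer_polyhedron P,
        forall v, K v -> P v -> covered X v,
        forall v, v \in vs -> vertices P v
      & forall v, vertices P v -> v \in vs \/ covered X v]
  | Done X P => [/\ finite_minimizers X, outer_polyhedron P
      & vertices P `<=` covered X]
  end.

Lemma covered_add X x v : covered X v -> covered (x |` X) v.
Proof. by move=> [y [z [Xy ze Cy]]]; exists y, z; split=> //; right. Qed.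

Lemma outer_polyhedron_cut P u t : outer_polyhedron P ->
  minkowski_sum (G @` S) C `<=` halfspace u t -> outer_polyhedron (P `&` halfspace u t).
Proof.
move=> [I [a [b [PE rec FP]]]] Fu.
exists (option I), (oapp a u), (oapp b t); split.
- rewrite PE; apply/seteqP; split=> [y [Py uy] [i|] _ //=|y Py].
    exact: Py.
  by split; [move=> i _; exact: (Py (Some i) Logic.I)|exact: (Py None Logic.I)].
- by move=> d ad; apply: rec => i; exact: (ad (Some i)).
- by move=> y Fy; split; [exact: FP|exact: Fu].
Qed.

Hypotheses (normN : is_norm N) (C0 : C 0) (convC : convex_set C) (coneC : is_cone C).

Lemma image_plus_cone_halfspace u x : dual_cone C u -> WS_opt G S u x ->
  minkowski_sum (G @` S) C `<=` halfspace u (dot u (G x)).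
Proof.
move=> Cu [_ xmin] _ [_ [x' Sx' <-] [c Cc <-]].
by rewrite /halfspace /= dotDr (le_trans (xmin _ Sx'))// lerDl Cu.
Qed.

(** This is the approximation guarantee: the right-hand side is convex, stable
under adding elements of C, and contains the covered points. *)
Lemma outer_polyhedron_sub_cover P X :
    outer_polyhedron P -> vertices P `<=` covered X ->
    (forall d, C d -> C (- d) -> d = 0) ->
  P `<=` minkowski_sum (minkowski_sum (conv_hull (G @` X)) C) (norm_ball N eps).
Proof.
move=> [I [a [b [-> rec _]]]] vX pointC.
apply: polyhedron_sub.
- by move=> d ad aNd; apply: pointC; exact: rec.
- apply: convex_minkowski_sum; last exact: convex_norm_ball.
  by apply: convex_minkowski_sum => //; exact: convex_conv_hull.
- move=> v /vX [x [z [Xx ze Cv]]].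
  exists (G x + (v + z - G x)).
    exists (G x); first by apply: sub_gen_smallest; exists x.
    by exists (v + z - G x).
  exists (- z); first by rewrite /norm_ball /= is_normNr.
  by rewrite addrCA subrr addr0 addrK.
- move=> _ d [_ [g hg [c Cc <-]] [z ze <-]] /rec Cd.
  exists (g + (c + d)); first by exists g => //; exists (c + d) => //; exact: cone_add.
  by exists z => //; rewrite addrA [LHS]addrAC.
Qed.

Lemma closure_sub_outer_polyhedron P : outer_polyhedron P -> upper_image C G S `<=` P.
Proof.
move=> [I [a [b [PE _ FP]]]]; rewrite /upper_image closureE.
apply: smallest_sub => //; rewrite PE; apply: closed_bigI => i _.
exact: closed_halfspace.
Qed.

Variable X : set 'rV[R]_n.
Hypotheses (convG : cone_convex C G X) (contG : {within X, continuous G}).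
Hypotheses (subSX : S `<=` X) (compactS : compact S) (convS : convex_set S).
Hypotheses (S0 : S !=set0) (q_gt0 : (0 < q)%N) (eps_gt0 : 0 < eps).

(** In a cut, strong duality shows that the new halfspace is valid and misses v. In
an addition, the new point is a weak minimizer for one of two reasons, according
to whether z vanishes. *)
Lemma alg_invariant_step c c' :
  alg_step N C G S eps c c' -> alg_invariant c -> alg_invariant c'.
Proof.
case=> {c c'} /=.
- move=> Y K P vs _ vsP [Ymin outP KP].
  have vsE v : v \in vs <-> vertices P v by rewrite -vsP.
  by split=> // v; [move/vsE|move=> /vsE; left].
- move=> Y K P v vs Kv [Ymin outP KP vsP Pvs]; split=> //.
    by move=> v' v'vs; apply: vsP; rewrite in_cons v'vs orbT.
  move=> v' /Pvs[|]; last by right.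
  rewrite in_cons => /orP[/eqP ->|]; last by left.
  by right; apply: KP => //; have [] := vsP v (mem_head _ _).
- move=> Y K P v vs x z u _ Pxz Du epsz [Ymin outP KP vsP Pvs].
  have [WSx ux] := strong_duality normN convC coneC C0 convG contG subSX compactS
    convS S0 Pxz Du (lt_trans eps_gt0 epsz).
  have [[_ Cu] _] := Du.
  split=> //.
    exact/outer_polyhedron_cut/image_plus_cone_halfspace.
  move=> v' [->|Kv'] [Pv'] ; last by move=> _; exact: KP.
  by rewrite /halfspace /= ux gerDl leNgt (lt_trans eps_gt0 epsz).
- move=> Y K P v vs x z u _ Pxz Du zeps [[Y0 finY Ymin] outP KP vsP Pvs].
  have vP : vertices P v by apply: vsP; rewrite mem_head.
  have [[/= Cxz Sx] _] := Pxz.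
  have Cv : C (v + z - G x).
    rewrite (_ : _ - _ = 0 - (G x - z - v))//.
    by rewrite sub0r !opprB addrA.
  have covv : covered (x |` Y) v by exists x, z; split=> //; left.
  have minx : weak_minimizer C G S x.
    have [z0|z0] := eqVneq z 0.
      case: outP => [I [a [b [_ _ FP]]]].
      apply: (vertex_weak_minimizer convC coneC q_gt0 FP vP Sx).
      by move: Cv; rewrite z0 addr0.
    exact: (P_opt_weak_minimizer normN convC coneC C0 convG contG subSX compactS
      convS S0 Pxz Du (is_norm_gt0 normN z0)).
  split=> //.
  + split; first by exists x; left.
      by rewrite finite_setU; split=> //; exact: finite_set1.
    by move=> y [->//|]; exact: Ymin.
  + by move=> v' [->//|Kv'] Pv'; apply: covered_add; exact: KP.
  + by move=> v' v'vs; apply: vsP; rewrite in_cons v'vs orbT.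
  + move=> v' /Pvs[|cv']; last by right; exact: covered_add.
    by rewrite in_cons => /orP[/eqP ->|]; [right|left].
- move=> Y K P [Ymin outP KP vsP Pvs]; split=> //.
  by move=> v /Pvs[].
Qed.

Lemma alg_invariant_init (J : nat) (w : 'I_J -> 'rV[R]_q) c :
    polyhedral C -> (forall j, w j != 0) ->
    dual_cone C = conv_hull (cone_hull (range w)) ->
  alg_init G S w c -> alg_invariant c.
Proof.
move=> polyC w0 genC [x WSx] /=.
have Cw j := dual_cone_generator j genC.
have [j0] := generators_nonempty genC.
split=> //.
- split; first by exists (x j0), j0.
    exact: finite_image.
  by move=> _ [j _ <-]; exact: (WS_weak_minimizer (Cw j)).
- exists 'I_J, w, (fun j => dot (w j) (G (x j))); split=> //.
    move=> d wd; apply: polyhedral_bipolar => //.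
    exact: dual_cone_generators_ge0 genC wd.
  move=> y Fy j _; exact: image_plus_cone_halfspace Fy.
Qed.

End Invariant.

Theorem theorem5p4 (R : realType) (n q : nat) (n_gt0 : (0 < n)%N)
  (q_gt0 : (0 < q)%N)
  (N : 'rV[R]_q -> R) (normN : is_norm N)
  (C : set 'rV[R]_q) (polyC : polyhedral C) (closedC : closed C)
  (convC : convex_set C) (coneC : is_cone C)
  (solidC : solid C) (pointedC : pointed C) (nontrivC : nontrivial C)
  (X : set 'rV[R]_n) (convX : convex_set X)
  (G : 'rV[R]_n -> 'rV[R]_q) (convG : cone_convex C G X)
  (contG : {within X, continuous G})
  (S : set 'rV[R]_n) (subSX : S `<=` X) (compactS : compact S)
  (convS : convex_set S) (intS : S° !=set0)
  (eps : R) (eps_gt0 : 0 < eps)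
  (J : nat) (w : 'I_J -> 'rV[R]_q) (w_neq0 : forall j, w j != 0)
  (genC : dual_cone C = conv_hull (cone_hull (range w)))
  (Xbar : set 'rV[R]_n) (Pout : set 'rV[R]_q)
  (returned : alg_returns N C G S eps w Xbar Pout) :
  finite_weak_solution N C G S eps Xbar.
Proof.
have C0 : C 0 by case: nontrivC => -[sub0C _] _; exact: sub0C.
have S0 : S !=set0 by case: intS => x /interior_subset Sx; exists x.
have pointC d : C d -> C (- d) -> d = 0.
  move=> Cd CNd; apply: contrapT => /eqP d0; apply: pointedC.
  exists 0, d; split=> // t; rewrite add0r; have [t0|t0] := leP 0 t.
    exact: coneC.
  by rewrite -[t]opprK scaleNr -scalerN; apply: coneC => //; rewrite oppr_ge0 ltW.
have inv c : alg_reach N C G S eps w c -> alg_invariant N C G S eps c.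
  elim=> {}c; first exact: alg_invariant_init.
  move=> c' _ invc step; apply: alg_invariant_step step invc => //; eauto.
have [[Xbar0 finX minX] outP vX] := inv _ returned.
split=> //; first by move=> x /minX[].
apply: subset_trans (outer_polyhedron_sub_cover normN convC coneC outP vX pointC).
exact: closure_sub_outer_polyhedron.
Qed.
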